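(* Let $\mathbf{r}^{(k)}$, $k\in\{1,2,3,4,6,7,8,9\}$, be eight $C^1_{\#}$ Bezier patches of bi-degree $(3,3)$ forming a $G^1$-regular incomplete 9-patch surface, with patch $5$ missing, in which the function $\lambda$ is constant and the function $\kappa$ is zero along the common boundary curve between any two adjacent patches. Explicitly: for each $(i,j)\in\{(1,2),(2,3),(7,8),(8,9)\}$ one has $\mathbf{r}^{(i)}(u,1)=\mathbf{r}^{(j)}(u,0)$ for all $u\in[0,1]$, and $\mathbf{r}^{(j)}_v(u,0)=c_{ij}\,\mathbf{r}^{(i)}_v(u,1)$ for all $u\in[0,1]$ with a constant $c_{ij}$; and for each $(i,j)\in\{(1,4),(4,7),(3,6),(6,9)\}$ one has $\mathbf{r}^{(i)}(1,v)=\mathbf{r}^{(j)}(0,v)$ for all $v\in[0,1]$, and $\mathbf{r}^{(j)}_u(0,v)=c_{ij}\,\mathbf{r}^{(i)}_u(1,v)$ for all $v\in[0,1]$ with a constant $c_{ij}$. Then there exists a Bezier patch $\mathbf{r}^{(5)}$ of bi-degree $(5,5)$ filling the hole such that the complete 9-patch surface is $G^1$-continuous, in the sense that $$\mathbf{r}^{(5)}(u,0)=\mathbf{r}^{(4)}(u,1),\quad \mathbf{r}^{(5)}(0,v)=\mathbf{r}^{(2)}(1,v),\quad \mathbf{r}^{(5)}(u,1)=\mathbf{r}^{(6)}(u,0),\quad \mathbf{r}^{(5)}(1,v)=\mathbf{r}^{(8)}(0,v)$$ for all $u,v\in[0,1]$, and there exist continuous functions $\lambda_{i,5},\kappa_{i,5}:[0,1]\to\mathbb{R}$,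 $i=2,4,6,8$, such that for all $u,v\in[0,1]$ $$\begin{aligned} \mathbf{r}^{(5)}_v(u,0)&=\lambda_{4,5}(u)\,\mathbf{r}^{(4)}_v(u,1)+\kappa_{4,5}(u)\,\mathbf{r}^{(4)}_u(u,1),\\ \mathbf{r}^{(5)}_u(0,v)&=\lambda_{2,5}(v)\,\mathbf{r}^{(2)}_u(1,v)+\kappa_{2,5}(v)\,\mathbf{r}^{(2)}_v(1,v),\\ \mathbf{r}^{(5)}_v(u,1)&=\lambda_{6,5}(u)\,\mathbf{r}^{(6)}_v(u,0)+\kappa_{6,5}(u)\,\mathbf{r}^{(6)}_u(u,0),\\ \mathbf{r}^{(5)}_u(1,v)&=\lambda_{8,5}(v)\,\mathbf{r}^{(8)}_u(0,v)+\kappa_{8,5}(v)\,\mathbf{r}^{(8)}_v(0,v). \end{aligned}$$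
   Context: A Bezier patch of bi-degree $(m,n)$ is a map $\mathbf{r}(u,v)=\sum_{i=0}^{m}\sum_{j=0}^{n}\mathbf{q}_{ij}B_i^{(m)}(u)B_j^{(n)}(v)$, $u,v\in[0,1]$, with control points $\mathbf{q}_{ij}\in\mathbb{R}^3$ and Bernstein polynomials $B_i^{(n)}(u)=\binom{n}{i}(1-u)^{n-i}u^i$. A patch is of class $C^1_{\#}$ if it is continuously differentiable on $[0,1]^2$ with $\mathbf{r}_u\times\mathbf{r}_v\ne0$ everywhere. Subscripts $u,v$ denote partial derivatives. The nine patches are arranged in a $3\times3$ grid, with $u$ increasing from left to right and $v$ increasing from bottom to top: left column (bottom to top) patches $1,2,3$; middle column $4,5,6$; right column $7,8,9$; the hole is patch $5$. In this setting two patches joined along a common boundary curve are said to join $G^1$-continuously when the cross-boundary derivative of one patch is a combination, with continuous coefficient functions $\lambda$ and $\kappa$ of the boundary parameter, of the cross-boundary derivative (coefficient $\lambda$) and the derivative along the boundary (coefficient $\kappa$) of the other patch. *)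

(* Defs.v *)
From HB Require Import structures.
From mathcomp Require Import all_boot all_order all_algebra.
From mathcomp Require Import all_classical all_reals all_analysis.

Set Implicit Arguments.
Unset Strict Implicit.
Unset Printing Implicit Defensive.

Import Order.TTheory GRing.Theory Num.Theory.
Import numFieldNormedType.Exports.

Local Open Scope classical_set_scope.
Local Open Scope ring_scope.

Definition bernstein (R : realType) (n i : nat) (t : R) : R :=
  'C(n, i)%:R * (1 - t) ^+ (n - i) * t ^+ i.

(* The patch is the restriction to [0, 1]^2 of this polynomial map on R^2. As
   the extension is smooth, its partial derivatives at points of the boundary of
   the square are the (one-sided) partial derivatives of the patch. *)
Definition bezier (R : realType) (m n : nat)
    (q : 'I_m.+1 -> 'I_n.+1 -> 'rV[R]_3) (u v : R) : 'rV[R]_3 :=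
  \sum_(i < m.+1) \sum_(j < n.+1) (bernstein m i u * bernstein n j v) *: q i j.

Definition dfdu (R : realType) (r : R -> R -> 'rV[R]_3) (u v : R) : 'rV[R]_3 :=
  derive1 (fun x : R => r x v) u.

Definition dfdv (R : realType) (r : R -> R -> 'rV[R]_3) (u v : R) : 'rV[R]_3 :=
  derive1 (fun y : R => r u y) v.

(* Indices are in Z/3, so that (a x b)_i = a_(i+1) b_(i+2) - a_(i+2) b_(i+1)
   with i + 1 and i + 2 taken cyclically. *)
Definition cross (R : realType) (a b : 'rV[R]_3) : 'rV[R]_3 :=
  \row_(i < 3) (a ord0 (i + 1) * b ord0 (i + 2) - a ord0 (i + 2) * b ord0 (i + 1)).

Definition unit_square (R : realType) : set (R * R) :=
  [set p | 0 <= p.1 <= 1 /\ 0 <= p.2 <= 1].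

(* The class C^1_#: continuously differentiable on the closed square (both
   partial derivatives exist and are jointly continuous) and regular. *)
Definition C1_sharp (R : realType) (r : R -> R -> 'rV[R]_3) : Prop :=
  [/\ forall u v : R, unit_square (u, v) ->
        derivable (fun x : R => r x v) u 1 /\ derivable (fun y : R => r u y) v 1,
      {within @unit_square R, continuous (fun p : R * R => dfdu r p.1 p.2)},
      {within @unit_square R, continuous (fun p : R * R => dfdv r p.1 p.2)} &
      forall u v : R, unit_square (u, v) ->
        cross (dfdu r u v) (dfdv r u v) != 0].

(* s lies above r: G^1 join along the edge v = 1 of r and v = 0 of s, with
   lambda constant and kappa = 0. *)
Definition joined_above (R : realType) (r s : R -> R -> 'rV[R]_3) : Prop :=
  (forall u : R, 0 <= u <= 1 -> r u 1 = s u 0) /\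
  (exists c : R, forall u : R, 0 <= u <= 1 -> dfdv s u 0 = c *: dfdv r u 1).

(* s lies to the right of r: same, along u = 1 of r and u = 0 of s. *)
Definition joined_right (R : realType) (r s : R -> R -> 'rV[R]_3) : Prop :=
  (forall v : R, 0 <= v <= 1 -> r 1 v = s 0 v) /\
  (exists c : R, forall v : R, 0 <= v <= 1 -> dfdu s 0 v = c *: dfdu r 1 v).

(* Along a common boundary curve with parameter t, the cross-boundary derivative
   d of one patch is a combination, with continuous coefficients, of the
   cross-boundary derivative a and the boundary derivative b of the other. *)
Definition G1_condition (R : realType) (d a b : R -> 'rV[R]_3) : Prop :=
  exists lambda kappa : R -> R,
    [/\ {within `[0, 1], continuous lambda},
        {within `[0, 1], continuous kappa} &
        forall t : R, 0 <= t <= 1 -> d t = lambda t *: a t + kappa t *: b t].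

(* Main.v *)
Require Import Defs.
From mathcomp Require Import all_boot all_order all_algebra.
From mathcomp Require Import all_classical all_reals all_analysis.
From mathcomp Require Import ring.

Set Implicit Arguments.
Unset Strict Implicit.
Unset Printing Implicit Defensive.

Import Order.TTheory GRing.Theory Num.Theory.
Import numFieldNormedType.Exports.

Local Open Scope ring_scope.

(** Along the lower edge of the hole put
    r5_v(u, 0) = lam(u) r4_v(u, 1) + kap(u) r4_u(u, 1), and likewise along the
    three other edges. The two ribbons that meet at a vertex of the hole must
    agree there, each with the tangent of the other edge, and both in the twist
    r5_uv. Each of the patches 1, 7, 3, 9 is a hub: it faces one vertex of the
    hole and is glued to the two edge patches that end there. If c and d are the
    ratios of its seams with the patches beside the vertical and the horizontal
    edge, the partial derivatives of these patches at the vertex are those of the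
    hub up to the factors c and d ([hub_corner]). Hence lam must be c at the
    vertex and kap must be 0, and similarly with d on the vertical edge; the terms
    lam r4_uv and its analogue then are both c d times the twist of the hub.
    Were lam stationary at both endpoints, nothing else would contribute to the
    twists, but this takes a cubic lam and a ribbon of degree 6. So lam is taken
    linear, and the term lam' r4_v which it adds to the twist is a multiple of the
    tangent of the adjacent boundary curve; a cubic kap on that adjacent edge,
    with kap = 0 and kap' prescribed at the endpoints, adds the same term there.
    Prescribing kap' requires dividing by the seam ratios, which do not vanish
    because the patches are regular. The ribbons have degree 1 + 3 and 3 + 2, so
    at most 5 ([frame_fill]).

    A compatible frame of boundary curves and ribbons is filled by the boolean
    sum of the two cubic Hermite interpolations, that is, by the bicubically
    blended Coons patch ([hermite_fill]). It is a sum of products of a cubic in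
    one parameter and a curve of degree at most 5 in the other, so it has
    bi-degree (5, 5), and Bernstein polynomials span the polynomials of degree
    at most 5 ([bernstein_expansion]), so it is a Bezier patch.

    Derivatives are computed on formal polynomial curves. The hypotheses hold on
    [0, 1] only, but an identity between polynomials on [0, 1] holds everywhere
    and can be differentiated ([unit_interval_curve_eq]); this is how the
    equality of cross derivatives along a seam yields the twists. *)

(** * Polynomial curves *)

Notation curve R := 'rV[{poly R}]_3.

Definition ceval {R : realType} (F : curve R) (t : R) : 'rV[R]_3 :=
  map_mx (horner_eval t) F.

Definition cderiv {R : realType} (k : nat) (F : curve R) : curve R :=
  map_mx (derivn k) F.

Definition cst_curve {R : realType} (w : 'rV[R]_3) : curve R :=
  map_mx polyC w.

Definition cdegree_le {R : realType} (n : nat) (F : curve R) : Prop :=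
  forall j, (size (F ord0 j) <= n.+1)%N.

Lemma cevalD {R : realType} (F G : curve R) t :
  ceval (F + G) t = ceval F t + ceval G t.
Proof. exact: map_mxD. Qed.

Lemma cevalZ {R : realType} (p : {poly R}) (F : curve R) t :
  ceval (p *: F) t = p.[t] *: ceval F t.
Proof. exact: map_mxZ. Qed.

Lemma ceval_sum {R : realType} (I : finType) (F : I -> curve R) t :
  ceval (\sum_i F i) t = \sum_i ceval (F i) t.
Proof.
apply/rowP => j; rewrite !mxE !summxE rmorph_sum/=.
by apply: eq_bigr => i _; rewrite !mxE.
Qed.

Lemma cevalB {R : realType} (F G : curve R) t :
  ceval (F - G) t = ceval F t - ceval G t.
Proof. exact: map_mxB. Qed.

Lemma ceval_cst {R : realType} (w : 'rV[R]_3) t : ceval (cst_curve w) t = w.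
Proof. by apply/rowP => j; rewrite !mxE /horner_eval hornerC. Qed.

Lemma cderiv0 {R : realType} (F : curve R) : cderiv 0 F = F.
Proof. by apply/rowP => j; rewrite !mxE. Qed.

Lemma cderivD {R : realType} k (F G : curve R) :
  cderiv k (F + G) = cderiv k F + cderiv k G.
Proof. exact: map_mxD. Qed.

Lemma cderivB {R : realType} k (F G : curve R) :
  cderiv k (F - G) = cderiv k F - cderiv k G.
Proof. exact: map_mxB. Qed.

Lemma cderiv_sum {R : realType} (I : finType) k (F : I -> curve R) :
  cderiv k (\sum_i F i) = \sum_i cderiv k (F i).
Proof.
apply/rowP => j; rewrite !mxE !summxE raddf_sum/=.
by apply: eq_bigr => i _; rewrite !mxE.
Qed.

Lemma cderivC {R : realType} k (c : R) (F : curve R) :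
  cderiv k (c%:P *: F) = c%:P *: cderiv k F.
Proof. by apply/rowP => j; rewrite !mxE !mul_polyC derivnZ. Qed.

Lemma cderivZcst {R : realType} k (p : {poly R}) (w : 'rV[R]_3) :
  cderiv k (p *: cst_curve w) = derivn k p *: cst_curve w.
Proof.
by apply/rowP => j; rewrite !mxE mulrC mul_polyC derivnZ -mul_polyC mulrC.
Qed.

Lemma cderivZ {R : realType} (p : {poly R}) (F : curve R) :
  cderiv 1 (p *: F) = deriv p *: F + p *: cderiv 1 F.
Proof. by apply/rowP => j; rewrite !mxE !derivn1 derivM. Qed.

Lemma derive1_ceval {R : realType} (F : curve R) (t : R) :
  derive1 (ceval F) t = ceval (cderiv 1 F) t.
Proof.
have dF (i : 'I_1) j : is_derive t 1 (fun x => ceval F x i j)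
    (ceval (cderiv 1 F) t i j).
  rewrite [X in is_derive _ _ X _](_ : _ = horner (F i j)).
    by rewrite !mxE; exact: is_derive_poly.
  by apply/funext => x; rewrite mxE.
rewrite derive1E derive_mx.
  by apply/matrixP => i j; rewrite mxE; apply: derive_val.
by apply/derivable_mxP => i j; have [] := dF i j.
Qed.

(** The difference vanishes at every 1 / (i + 1), more points than its degree. *)
Lemma unit_interval_poly_eq {R : realType} (p q : {poly R}) :
  (forall t, 0 <= t <= 1 -> p.[t] = q.[t]) -> p = q.
Proof.
move=> pq; apply/subr0_eq.
pose s := [seq (i.+1%:R : R)^-1 | i <- iota 0 (size (p - q))].
apply: (@roots_geq_poly_eq0 _ _ s); last by rewrite size_map size_iota.
  apply/allP => _ /mapP[i _ ->]; rewrite rootE !hornerE pq ?subrr//.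
  by rewrite invr_ge0 ler0n/= invf_le1 ?ltr0n// ler1n.
rewrite map_inj_uniq ?iota_uniq// => i j /invr_inj/eqP.
by rewrite eqr_nat => /eqP[].
Qed.

Lemma unit_interval_curve_eq {R : realType} (F G : curve R) :
  (forall t, 0 <= t <= 1 -> ceval F t = ceval G t) -> F = G.
Proof.
move=> FG; apply/rowP => j; apply: unit_interval_poly_eq => t /FG/rowP/(_ j).
by rewrite !mxE.
Qed.

Lemma cdegree_leW {R : realType} m n (F : curve R) :
  (m <= n)%N -> cdegree_le m F -> cdegree_le n F.
Proof. by move=> mn dF j; exact: leq_trans (dF j) _. Qed.

Lemma cdegree_leD {R : realType} n (F G : curve R) :
  cdegree_le n F -> cdegree_le n G -> cdegree_le n (F + G).
Proof.
move=> dF dG j; rewrite mxE (leq_trans (size_polyD _ _))//.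
by rewrite geq_max dF dG.
Qed.

Lemma cdegree_leN {R : realType} n (F : curve R) :
  cdegree_le n F -> cdegree_le n (- F).
Proof. by move=> dF j; rewrite mxE size_polyN. Qed.

Lemma cdegree_le_sum {R : realType} (I : finType) n (F : I -> curve R) :
  (forall i, cdegree_le n (F i)) -> cdegree_le n (\sum_i F i).
Proof.
move=> dF; apply: big_ind => [j| |i _]; [|exact: cdegree_leD|exact: dF].
by rewrite mxE size_poly0.
Qed.

Lemma cdegree_leZ {R : realType} m n (p : {poly R}) (F : curve R) :
  (size p <= m.+1)%N -> cdegree_le n F -> cdegree_le (m + n) (p *: F).
Proof.
move=> sp dF j; rewrite mxE (leq_trans (size_polyMleq _ _))//.
rewrite (@leq_trans (m.+1 + n.+1).-1)//; last by rewrite addSn addnS.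
by rewrite -!subn1 leq_sub2r// leq_add.
Qed.

Lemma cdegree_le_cst {R : realType} (w : 'rV[R]_3) : cdegree_le 0 (cst_curve w).
Proof. by move=> j; rewrite mxE size_polyC leq_b1. Qed.

Lemma cdegree_le_deriv {R : realType} n (F : curve R) :
  cdegree_le n.+1 F -> cdegree_le n (cderiv 1 F).
Proof.
move=> dF j; rewrite mxE derivn1; apply/leq_sizeP => i le_ni.
by rewrite coef_deriv (leq_sizeP _ _ (dF j)) ?mul0rn.
Qed.

(** * Expansion in the Bernstein basis *)

Definition bernp {R : realType} (n i : nat) : {poly R} :=
  'C(n, i)%:R * (1 - 'X) ^+ (n - i) * 'X ^+ i.

Lemma horner_bernp {R : realType} n i (t : R) : (bernp n i).[t] = bernstein n i t.
Proof. by rewrite /bernp -polyC_natr /bernstein !hornerE. Qed.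

Lemma size_bernp {R : realType} n i : (i <= n)%N ->
  (size (@bernp R n i) <= n.+1)%N.
Proof.
move=> le_in; rewrite /bernp -polyC_natr -mulrA mul_polyC.
apply: leq_trans (size_scale_leq _ _) _.
rewrite -opprB exprNn -signr_odd.
rewrite -mulrA mulr_sign; case: ifP => _; rewrite ?size_polyN -polyC1;
  rewrite size_Mmonic ?monicXn ?size_exp_XsubC ?size_polyXn;
  rewrite ?expf_neq0 ?polyXsubC_eq0//.
all: by rewrite addSn /= addnS/= subnK.
Qed.

Definition bern_coef {R : realType} (n : nat) (p : {poly R}) (i : nat) : R :=
  \sum_(k < n.+1) p`_k * ('C(i, k)%:R / 'C(n, k)%:R).

Lemma bin_mul_sub n k i : (k <= n)%N -> (i <= n - k)%N ->
  ('C(i + k, k) * 'C(n, i + k) = 'C(n, k) * 'C(n - k, i))%N.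
Proof.
move=> le_kn le_i.
have le_ik : (i + k <= n)%N by rewrite addnC -leq_subRL.
apply/eqP; rewrite -(eqn_pmul2r (fact_gt0 k)) -(eqn_pmul2r (fact_gt0 i)).
rewrite -(eqn_pmul2r (fact_gt0 (n - k - i))); apply/eqP.
have := bin_fact (leq_addl i k); rewrite addnK.
have := bin_fact le_ik.
have -> : (n - (i + k) = n - k - i)%N by rewrite addnC subnDA.
have := bin_fact le_kn; have := bin_fact le_i.
move: ((n - k - i)`!) ((n - k)`!) ((i + k)`!) => f1 f2 f3 e3 e2 e1 e4.
transitivity n`!; first by rewrite -e1 -e4; ring.
by rewrite -e2 -e3; ring.
Qed.

(** Multiply t^k by 1 = (1 - t + t)^(n - k) and expand: the term of index i is
    proportional to the Bernstein polynomial of index i + k. *)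
Lemma bernstein_exp {R : realType} n k (t : R) : (k <= n)%N ->
  t ^+ k = \sum_(i < n.+1) ('C(i, k)%:R / 'C(n, k)%:R) * bernstein n i t.
Proof.
move=> le_kn.
have nz : ('C(n, k)%:R : R) != 0 by rewrite pnatr_eq0 -lt0n bin_gt0.
have -> : t ^+ k = (1 - t + t) ^+ (n - k) * t ^+ k by rewrite subrK expr1n mul1r.
rewrite exprDn mulr_suml.
rewrite -(big_mkord xpredT (fun i => 'C(i, k)%:R / 'C(n, k)%:R * bernstein n i t)).
(* The terms with i < k vanish; the others are reindexed from 0. *)
rewrite (@big_cat_nat _ _ _ k) ?leq0n ?(leqW le_kn)//=.
rewrite [X in _ = X + _]big_nat [X in _ = X + _]big1 ?add0r; last first.
  by move=> i /andP[_ lt_ik]; rewrite bin_small// !mul0r.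
rewrite [RHS](_ : _ = \sum_(0 + k <= i < n.+1)
  'C(i, k)%:R / 'C(n, k)%:R * bernstein n i t)// big_addn subSn//.
rewrite big_mkord; apply: eq_bigr => i _.
have le_i : (i <= n - k)%N by rewrite -ltnS.
rewrite /bernstein exprD.
rewrite (_ : n - (i + k) = n - k - i)%N; last by rewrite addnC subnDA.
have bin_bin := bin_mul_sub le_kn le_i.
rewrite -mulr_natr; apply: (mulfI nz); rewrite mulrA.
have /(congr1 (fun m => m%:R : R)) := bin_bin; rewrite !natrM => bb.
transitivity ('C(n, k)%:R * 'C(n - k, i)%:R *
    ((1 - t) ^+ (n - k - i) * t ^+ i * t ^+ k)).
  by ring.
by rewrite -bb; field.
Qed.

Lemma bernstein_expansion {R : realType} n (p : {poly R}) (t : R) :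
  (size p <= n.+1)%N ->
  p.[t] = \sum_(i < n.+1) bern_coef n p i * bernstein n i t.
Proof.
move=> szp; rewrite (horner_coef_wide _ szp).
under [RHS]eq_bigr do rewrite mulr_suml.
rewrite exchange_big; apply: eq_bigr => k _ /=.
rewrite (@bernstein_exp _ n k) ?mulr_sumr -1?ltnS//.
by apply: eq_bigr => i _; rewrite mulrA.
Qed.

Lemma curve_bernstein_expansion {R : realType} n (F : curve R) (t : R) :
  cdegree_le n F ->
  ceval F t =
  \sum_(i < n.+1) bernstein n i t *: map_mx (fun p => bern_coef n p i) F.
Proof.
move=> dF; apply/rowP => j; rewrite mxE summxE [LHS](@bernstein_expansion _ n)//.
by apply: eq_bigr => i _; rewrite !mxE mulrC.
Qed.

(** * Isoparametric curves of a patch *)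

Definition swap_net {R : realType} {m n : nat}
    (q : 'I_m.+1 -> 'I_n.+1 -> 'rV[R]_3) : 'I_n.+1 -> 'I_m.+1 -> 'rV[R]_3 :=
  fun i j => q j i.

Lemma swap_netK {R : realType} m n (q : 'I_m.+1 -> 'I_n.+1 -> 'rV[R]_3) :
  swap_net (swap_net q) = q.
Proof. by []. Qed.

Lemma bezier_swap {R : realType} m n (q : 'I_m.+1 -> 'I_n.+1 -> 'rV[R]_3) u v :
  bezier (swap_net q) v u = bezier q u v.
Proof.
rewrite /bezier exchange_big; apply: eq_bigr => i _; apply: eq_bigr => j _.
by rewrite mulrC.
Qed.

Lemma dfdv_swap {R : realType} m n (q : 'I_m.+1 -> 'I_n.+1 -> 'rV[R]_3) u v :
  dfdv (bezier q) u v = dfdu (bezier (swap_net q)) v u.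
Proof.
rewrite /dfdv /dfdu.
suff -> : bezier q u = (bezier (swap_net q))^~ u by [].
by apply/funext => y; rewrite bezier_swap.
Qed.

(** For every v, the polynomial in u whose values are the derivatives of order l
    in v of the patch. *)
Definition uiso {R : realType} {m n : nat}
    (q : 'I_m.+1 -> 'I_n.+1 -> 'rV[R]_3) (v : R) (l : nat) : curve R :=
  \sum_(i < m.+1) bernp m i *:
    cst_curve (\sum_(j < n.+1) (derivn l (bernp n j)).[v] *: q i j).

Definition viso {R : realType} {m n : nat}
    (q : 'I_m.+1 -> 'I_n.+1 -> 'rV[R]_3) (u : R) (k : nat) : curve R :=
  uiso (swap_net q) u k.

Lemma cdegree_uiso {R : realType} m n (q : 'I_m.+1 -> 'I_n.+1 -> 'rV[R]_3) v l :
  cdegree_le m (uiso q v l).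
Proof.
apply: cdegree_le_sum => i; apply: (@cdegree_leW _ (m + 0)).
  by rewrite addn0.
by apply: cdegree_leZ; [rewrite size_bernp// -ltnS | exact: cdegree_le_cst].
Qed.

Lemma uisoE {R : realType} m n (q : 'I_m.+1 -> 'I_n.+1 -> 'rV[R]_3) u v k l :
  ceval (cderiv k (uiso q v l)) u = \sum_(i < m.+1) \sum_(j < n.+1)
    ((derivn k (bernp m i)).[u] * (derivn l (bernp n j)).[v]) *: q i j.
Proof.
rewrite cderiv_sum ceval_sum; apply: eq_bigr => i _.
rewrite cderivZcst cevalZ ceval_cst scaler_sumr.
by apply: eq_bigr => j _; rewrite scalerA.
Qed.

(** Partial derivatives commute: differentiating l times in v before k times in
    u, or in the other order, gives the same double sum. *)
Lemma mixed_partials {R : realType} m n (q : 'I_m.+1 -> 'I_n.+1 -> 'rV[R]_3)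
    u v k l :
  ceval (cderiv k (uiso q v l)) u = ceval (cderiv l (viso q u k)) v.
Proof.
rewrite /viso !uisoE exchange_big; apply: eq_bigr => i _; apply: eq_bigr => j _.
by rewrite mulrC.
Qed.

Lemma bezier_uiso {R : realType} m n (q : 'I_m.+1 -> 'I_n.+1 -> 'rV[R]_3) u v :
  bezier q u v = ceval (uiso q v 0) u.
Proof.
rewrite -[uiso _ _ _]cderiv0 uisoE; apply: eq_bigr => i _; apply: eq_bigr => j _.
by rewrite !derivn0 !horner_bernp.
Qed.

Lemma bezier_viso {R : realType} m n (q : 'I_m.+1 -> 'I_n.+1 -> 'rV[R]_3) u v :
  bezier q u v = ceval (viso q u 0) v.
Proof. by rewrite -bezier_swap bezier_uiso. Qed.

Lemma dfdu_uiso {R : realType} m n (q : 'I_m.+1 -> 'I_n.+1 -> 'rV[R]_3) u v :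
  dfdu (bezier q) u v = ceval (cderiv 1 (uiso q v 0)) u.
Proof.
rewrite -derive1_ceval /dfdu.
suff -> : (bezier q)^~ v = ceval (uiso q v 0) by [].
by apply/funext => x; rewrite bezier_uiso.
Qed.

Lemma dfdu_viso {R : realType} m n (q : 'I_m.+1 -> 'I_n.+1 -> 'rV[R]_3) u v :
  dfdu (bezier q) u v = ceval (viso q u 1) v.
Proof. by rewrite dfdu_uiso mixed_partials cderiv0. Qed.

Lemma dfdv_uiso {R : realType} m n (q : 'I_m.+1 -> 'I_n.+1 -> 'rV[R]_3) u v :
  dfdv (bezier q) u v = ceval (uiso q v 1) u.
Proof. by rewrite dfdv_swap dfdu_viso. Qed.

Lemma dfdv_viso {R : realType} m n (q : 'I_m.+1 -> 'I_n.+1 -> 'rV[R]_3) u v :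
  dfdv (bezier q) u v = ceval (cderiv 1 (viso q u 0)) v.
Proof. by rewrite dfdv_swap dfdu_uiso. Qed.

(** * Surfaces with a Bezier net *)

Definition patch {R : realType} (n : nat) (f : R -> R -> 'rV[R]_3) : Prop :=
  exists q : 'I_n.+1 -> 'I_n.+1 -> 'rV[R]_3, forall u v, bezier q u v = f u v.

Lemma patch_swap {R : realType} n (f : R -> R -> 'rV[R]_3) :
  patch n f -> patch n (fun u v => f v u).
Proof. by move=> [q qf]; exists (swap_net q) => u v; rewrite bezier_swap. Qed.

Lemma patchD {R : realType} n (f g : R -> R -> 'rV[R]_3) :
  patch n f -> patch n g -> patch n (fun u v => f u v + g u v).
Proof.
move=> [p pf] [q qg]; exists (fun i j => p i j + q i j) => u v.
rewrite -pf -qg /bezier -big_split; apply: eq_bigr => i _.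
by rewrite -big_split; apply: eq_bigr => j _; rewrite scalerDr.
Qed.

Lemma patch_sum {R : realType} n (I : finType) (f : I -> R -> R -> 'rV[R]_3) :
  (forall a, patch n (f a)) -> patch n (fun u v => \sum_a f a u v).
Proof.
move=> /choice[q qf]; exists (fun i j => \sum_a q a i j) => u v.
under [RHS]eq_bigr do rewrite -qf.
rewrite [RHS]exchange_big; apply: eq_bigr => i _.
rewrite [RHS]exchange_big; apply: eq_bigr => j _.
by rewrite scaler_sumr.
Qed.

Lemma patch_tensor {R : realType} n (p : {poly R}) (G : curve R) :
  (size p <= n.+1)%N -> cdegree_le n G ->
  patch n (fun u v => p.[u] *: ceval G v).
Proof.
move=> sp dG.
exists (fun i j => bern_coef n p i *: map_mx (fun p => bern_coef n p j) G) => u v.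
rewrite (bernstein_expansion _ sp) (curve_bernstein_expansion _ dG).
rewrite scaler_suml; apply: eq_bigr => i _.
rewrite scaler_sumr; apply: eq_bigr => j _; rewrite !scalerA.
by congr (_ *: _); ring.
Qed.

(** * Cubic Hermite interpolation and Coons patches *)

Definition cubic {R : realType} (a b c d : R) : {poly R} :=
  a%:P + b *: 'X + c *: 'X^2 + d *: 'X^3.

Lemma size_cubic {R : realType} (a b c d : R) : (size (cubic a b c d) <= 4)%N.
Proof.
apply/leq_sizeP => i le4i; rewrite /cubic !coefD !coefZ coefC coefX !coefXn.
by case: i le4i => [|[|[|[|i]]]]//= _; rewrite !mulr0 !addr0.
Qed.

Lemma horner_cubic {R : realType} (a b c d x : R) :
  (cubic a b c d).[x] = a + b * x + c * x ^+ 2 + d * x ^+ 3.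
Proof. by rewrite /cubic !hornerE. Qed.

Lemma horner_deriv_cubic {R : realType} (a b c d x : R) :
  (deriv (cubic a b c d)).[x] = b + 2 * c * x + 3 * d * x ^+ 2.
Proof. by rewrite /cubic !poly.derivE !hornerE /=; ring. Qed.

(** The index a = (e, i) stands for the derivative of order i at the endpoint e,
    booleans being read as 0 and 1. *)
Definition hermite_basis {R : realType} (a : bool * bool) : {poly R} :=
  match a with
  | (false, false) => cubic 1 0 (- 3) 2
  | (false, true) => cubic 0 1 (- 2) 1
  | (true, false) => cubic 0 0 3 (- 2)
  | (true, true) => cubic 0 0 (- 1) 1
  end.

Lemma size_hermite_basis {R : realType} a :
  (size (@hermite_basis R a) <= 4)%N.
Proof. by case: a => [[] []]; exact: size_cubic. Qed.

(** Duality between the basis and the four endpoint functionals. *)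
Lemma hermite_basisP {R : realType} (a b : bool * bool) :
  (derivn a.2 (@hermite_basis R b)).[a.1%:R] = (a == b)%:R.
Proof.
case: a b => [[] []] [[] []]; rewrite /= ?derivn0 ?derivn1;
  rewrite ?horner_cubic ?horner_deriv_cubic /= ?mulr0n ?mulr1n; ring.
Qed.

Definition jet {R : realType} (a : bool * bool) (F : curve R) : 'rV[R]_3 :=
  ceval (cderiv a.2 F) a.1%:R.

Definition hermite {R : realType} (w : bool * bool -> 'rV[R]_3) : curve R :=
  \sum_a hermite_basis a *: cst_curve (w a).

Lemma ceval_hermite {R : realType} (w : bool * bool -> 'rV[R]_3) t :
  ceval (hermite w) t = \sum_a (hermite_basis a).[t] *: w a.
Proof.
by rewrite ceval_sum; apply: eq_bigr => a _; rewrite cevalZ ceval_cst.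
Qed.

Lemma jet_hermite {R : realType} (w : bool * bool -> 'rV[R]_3) a :
  jet a (hermite w) = w a.
Proof.
rewrite /jet cderiv_sum ceval_sum (bigD1 a)//= big1 ?addr0 => [|b ba].
  by rewrite cderivZcst cevalZ ceval_cst hermite_basisP eqxx scale1r.
by rewrite cderivZcst cevalZ ceval_cst hermite_basisP eq_sym (negPf ba) scale0r.
Qed.

Lemma cdegree_hermite {R : realType} (w : bool * bool -> 'rV[R]_3) :
  cdegree_le 3 (hermite w).
Proof.
apply: cdegree_le_sum => a; apply: (@cdegree_leW _ (3 + 0)) => //.
by apply: cdegree_leZ; [exact: size_hermite_basis | exact: cdegree_le_cst].
Qed.

(** The boolean sum of the two Hermite interpolations, as a curve in u for fixed
    v: interpolate the data G of the edges u = 0, 1, then correct by interpolating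
    in v what this misses of the data F of the edges v = 0, 1. *)
Definition coons {R : realType} (G F : bool * bool -> curve R) (v : R) : curve R :=
  hermite (fun a => ceval (G a) v) +
  \sum_b (hermite_basis b).[v]%:P *: (F b - hermite (fun a => jet a (F b))).

(** The correction disappears at u = 0 and u = 1, since each of its terms is F b
    minus its own Hermite interpolant. *)
Lemma jet_coons {R : realType} (G F : bool * bool -> curve R) (v : R) a :
  jet a (coons G F v) = ceval (G a) v.
Proof.
rewrite /jet cderivD cevalD -[X in X + _]/(jet a _) jet_hermite.
rewrite cderiv_sum ceval_sum big1 ?addr0// => b _.
rewrite cderivC cevalZ cderivB cevalB -/(jet a (F b)) -/(jet a (hermite _)).
by rewrite jet_hermite subrr scaler0.
Qed.

Lemma coonsE {R : realType} (G F : bool * bool -> curve R) (u v : R) :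
  ceval (coons G F v) u =
  \sum_a (hermite_basis a).[u] *: ceval (G a) v +
  \sum_b (hermite_basis b).[v] *: ceval (F b - hermite (fun a => jet a (F b))) u.
Proof.
rewrite cevalD ceval_hermite ceval_sum; congr (_ + _).
by apply: eq_bigr => b _; rewrite cevalZ hornerC.
Qed.

(** When the data agree at the four vertices, the boolean sum is symmetric in the
    two directions, so it also interpolates F. *)
Lemma coons_swap {R : realType} (G F : bool * bool -> curve R) (u v : R) :
  (forall a b, jet a (F b) = jet b (G a)) ->
  ceval (coons G F v) u = ceval (coons F G u) v.
Proof.
move=> FG; rewrite !coonsE.
under [X in _ + X = _]eq_bigr do rewrite cevalB ceval_hermite scalerBr.
under [X in _ = _ + X]eq_bigr do rewrite cevalB ceval_hermite scalerBr.
rewrite !sumrB addrCA; congr (_ + (_ - _)).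
under eq_bigr do rewrite scaler_sumr.
under [RHS]eq_bigr do rewrite scaler_sumr.
rewrite exchange_big; apply: eq_bigr => a _; apply: eq_bigr => b _.
by rewrite !scalerA mulrC FG.
Qed.

Lemma coons_patch {R : realType} n (G F : bool * bool -> curve R) : (3 <= n)%N ->
  (forall a, cdegree_le n (G a)) -> (forall b, cdegree_le n (F b)) ->
  patch n (fun u v => ceval (coons G F v) u).
Proof.
move=> n3 dG dF; under eq_fun do under eq_fun do rewrite coonsE.
have sh a : (size (@hermite_basis R a) <= n.+1)%N.
  exact: leq_trans (size_hermite_basis a) _.
apply: patchD; apply: patch_sum => a; first exact: patch_tensor.
apply: (@patch_swap _ _ (fun v u => _)); apply: patch_tensor => //.
apply: cdegree_leD => //; apply: cdegree_leN.
exact: cdegree_leW (cdegree_hermite _).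
Qed.

(** The compatibility condition at a = (k, i), b = (l, j) says that both families
    predict the same mixed derivative of orders (i, j) at the vertex (k, l). *)
Lemma hermite_fill {R : realType} n (G F : bool * bool -> curve R) :
  (3 <= n)%N ->
  (forall a, cdegree_le n (G a)) -> (forall b, cdegree_le n (F b)) ->
  (forall a b, jet a (F b) = jet b (G a)) ->
  exists q : 'I_n.+1 -> 'I_n.+1 -> 'rV[R]_3,
    forall (k : bool) (t : R),
    [/\ bezier q k%:R t = ceval (G (k, false)) t,
        bezier q t k%:R = ceval (F (k, false)) t,
        dfdu (bezier q) k%:R t = ceval (G (k, true)) t &
        dfdv (bezier q) t k%:R = ceval (F (k, true)) t].
Proof.
move=> n3 dG dF FG; have [q qE] := coons_patch n3 dG dF.
(* Exchanging u and v reduces the edges v = 0, 1 to the edges u = 0, 1. *)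
have half (p : 'I_n.+1 -> 'I_n.+1 -> 'rV[R]_3) (G' F' : bool * bool -> curve R) :
    (forall u v, bezier p u v = ceval (coons G' F' v) u) ->
    forall (k : bool) t, bezier p k%:R t = ceval (G' (k, false)) t /\
      dfdu (bezier p) k%:R t = ceval (G' (k, true)) t.
  move=> pE k t; split.
    by rewrite pE -[coons _ _ _]cderiv0 -[LHS]/(jet (k, false) _) jet_coons.
  rewrite -[RHS](jet_coons G' F') /jet -derive1_ceval /dfdu.
  suff -> : (bezier p)^~ t = ceval (coons G' F' t) by [].
  exact/funext.
exists q => k t; have [q0 q1] := half _ _ _ qE k t.
have [u v|p0 p1] := half (swap_net q) F G _ k t.
  by rewrite bezier_swap qE coons_swap.
by split; rewrite // ?dfdv_swap// -bezier_swap.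
Qed.

(** * Ribbons along the edges of the hole *)

Definition line {R : realType} (w : bool -> R) : {poly R} :=
  (w false)%:P + (w true - w false) *: 'X.

Lemma horner_line {R : realType} (w : bool -> R) (k : bool) :
  (line w).[k%:R] = w k.
Proof. by rewrite /line !hornerE; case: k => /=; ring. Qed.

Lemma deriv_line {R : realType} (w : bool -> R) x :
  (deriv (line w)).[x] = w true - w false.
Proof. by rewrite /line !poly.derivE !hornerE. Qed.

Lemma size_line {R : realType} (w : bool -> R) : (size (line w) <= 2)%N.
Proof.
apply/leq_sizeP => i; rewrite /line !coefD !coefZ coefC coefX.
by case: i => [|[|i]]//= _; rewrite mulr0 addr0.
Qed.

(** It vanishes at 0 and 1 and has the slopes s there. *)
Definition slope_cubic {R : realType} (s : bool -> R) : {poly R} :=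
  s false *: hermite_basis (false, true) + s true *: hermite_basis (true, true).

Lemma horner_slope_cubic {R : realType} (s : bool -> R) (k : bool) :
  (slope_cubic s).[k%:R] = 0.
Proof.
have h b : (hermite_basis b).[k%:R] = ((k, false) == b)%:R :> R.
  exact: (hermite_basisP (k, false) b).
by rewrite /slope_cubic hornerD !hornerZ !h !xpair_eqE !andbF !mulr0 addr0.
Qed.

Lemma deriv_slope_cubic {R : realType} (s : bool -> R) (k : bool) :
  (deriv (slope_cubic s)).[k%:R] = s k.
Proof.
have h b : (deriv (hermite_basis b)).[k%:R] = ((k, true) == b)%:R :> R.
  exact: (hermite_basisP (k, true) b).
rewrite /slope_cubic derivD !derivZ hornerD !hornerZ !h !xpair_eqE !andbT.
by case: k {h}; rewrite /= ?mulr0 ?mulr1 ?addr0 ?add0r.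
Qed.

Lemma size_slope_cubic {R : realType} (s : bool -> R) : (size (slope_cubic s) <= 4)%N.
Proof.
rewrite (leq_trans (size_polyD _ _))// geq_max.
by rewrite !(leq_trans (size_scale_leq _ _)) ?size_hermite_basis.
Qed.

(** A candidate cross derivative of the filling patch along an edge, where A is
    the cross derivative of the neighbouring patch and B the edge. *)
Definition ribbon {R : realType} (w s : bool -> R) (A B : curve R) : curve R :=
  line w *: A + slope_cubic s *: cderiv 1 B.

Lemma cdegree_ribbon {R : realType} (w s : bool -> R) (A B : curve R) :
  cdegree_le 3 A -> cdegree_le 3 B -> cdegree_le 5 (ribbon w s A B).
Proof.
move=> dA dB; apply: cdegree_leD.
  by apply: (@cdegree_leW _ (1 + 3)) => //; apply: cdegree_leZ; first exact: size_line.
apply: (@cdegree_leW _ (3 + 2)) => //; apply: cdegree_leZ; first exact: size_slope_cubic.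
exact: cdegree_le_deriv.
Qed.

Lemma ceval_ribbon {R : realType} (w s : bool -> R) (A B : curve R) (k : bool) :
  ceval (ribbon w s A B) k%:R = w k *: ceval A k%:R.
Proof.
by rewrite cevalD !cevalZ horner_line horner_slope_cubic scale0r addr0.
Qed.

Lemma ceval_deriv_ribbon {R : realType} (w s : bool -> R) (A B : curve R)
    (k : bool) :
  ceval (cderiv 1 (ribbon w s A B)) k%:R =
  (w true - w false) *: ceval A k%:R + w k *: ceval (cderiv 1 A) k%:R +
  s k *: ceval (cderiv 1 B) k%:R.
Proof.
rewrite cderivD !cderivZ !cevalD !cevalZ horner_line horner_slope_cubic.
by rewrite deriv_line deriv_slope_cubic scale0r addr0.
Qed.

(** B, with cross derivative A, and C, with cross derivative E, are boundary
    curves in u and in v that meet at the vertex of parameters x on B and y on C.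
    The tangent of each must be a multiple of the cross derivative given along
    the other, and the two twists must agree after rescaling by these ratios. *)
Definition corner {R : realType} (B A C E : curve R) (x y al be : R) : Prop :=
  [/\ ceval B x = ceval C y,
      ceval (cderiv 1 C) y = al *: ceval A x,
      ceval (cderiv 1 B) x = be *: ceval E y &
      al *: ceval (cderiv 1 A) x = be *: ceval (cderiv 1 E) y].

(** The slopes of slope_cubic are chosen so that both ribbons at the vertex (k, l) have
    the same derivative. Differentiating the ribbon of B gives
    (al true l - al false l) A + al A' + s B', and B' = be E at the vertex, so
    s = (be k true - be k false) / be makes the last term equal to the term that
    the affine factor creates in the ribbon of C; the roles of the two edges are
    symmetric, and al A' = be E' by hypothesis. *)
Theorem frame_fill {R : realType} (B A C E : bool -> curve R)
    (al be : bool -> bool -> R) :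
  (forall k, [/\ cdegree_le 3 (B k), cdegree_le 3 (A k),
                 cdegree_le 3 (C k) & cdegree_le 3 (E k)]) ->
  (forall k l, al k l != 0) -> (forall k l, be k l != 0) ->
  (forall k l : bool,
     corner (B l) (A l) (C k) (E k) k%:R l%:R (al k l) (be k l)) ->
  exists (q : 'I_6 -> 'I_6 -> 'rV[R]_3) (lam kap mu nu : bool -> {poly R}),
    forall (k : bool) (t : R),
    [/\ bezier q k%:R t = ceval (C k) t,
        bezier q t k%:R = ceval (B k) t,
        dfdu (bezier q) k%:R t =
          (mu k).[t] *: ceval (E k) t + (nu k).[t] *: ceval (cderiv 1 (C k)) t &
        dfdv (bezier q) t k%:R =
          (lam k).[t] *: ceval (A k) t + (kap k).[t] *: ceval (cderiv 1 (B k)) t].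
Proof.
move=> deg al0 be0 cor.
pose sB l k := (be k true - be k false) / be k l.
pose sC k l := (al true l - al false l) / al k l.
pose F (b : bool * bool) := if b.2 then ribbon (al^~ b.1) (sB b.1) (A b.1) (B b.1)
                            else B b.1.
pose G (a : bool * bool) := if a.2 then ribbon (be a.1) (sC a.1) (E a.1) (C a.1)
                            else C a.1.
have [|a|b|a b|q qP] := @hermite_fill R 5 G F.
- by [].
- rewrite /G; have [_ _ dC dE] := deg a.1; case: ifP => _.
    exact: cdegree_ribbon.
  exact: cdegree_leW dC.
- rewrite /F; have [dB dA _ _] := deg b.1; case: ifP => _.
    exact: cdegree_ribbon.
  exact: cdegree_leW dB.
  (* The last of the four cases of orders (i, j) is the equality of twists. *)
- case: a b => [k i] [l j]; have [BC dC dB dAE] := cor k l.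
  rewrite /jet /F /G /=; case: i j => -[] /=; rewrite ?cderiv0 ?ceval_ribbon//.
  rewrite !ceval_deriv_ribbon dC dB !scalerA dAE /sB /sC !divfK//.
  by rewrite [LHS]addrC [LHS]addrA [LHS]addrAC.
exists q, (fun l => line (al^~ l)), (fun l => slope_cubic (sB l)),
  (fun k => line (be k)), (fun k => slope_cubic (sC k)) => k t.
have [q1 q2 q3 q4] := qP k t; split=> //.
  by rewrite q3 /G /= cevalD !cevalZ.
by rewrite q4 /F /= cevalD !cevalZ.
Qed.

(** * Seams between the given patches *)

(** P l and Q l are the derivatives of order l across the seam of the two patches
    that it joins. *)
Definition seam {R : realType} (P Q : nat -> curve R) : Prop :=
  P 0%N = Q 0%N /\ exists2 c : R, c != 0 & Q 1%N = c%:P *: P 1%N.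

Lemma seam_sym {R : realType} (P Q : nat -> curve R) : seam P Q -> seam Q P.
Proof.
move=> [PQ0 [c c0 PQ1]]; split=> //; exists c^-1; first by rewrite invr_eq0.
by rewrite PQ1 scalerA -polyCM mulVf// scale1r.
Qed.

Lemma C1_sharp_neq0 {R : realType} (r : R -> R -> 'rV[R]_3) u v :
  C1_sharp r -> 0 <= u <= 1 -> 0 <= v <= 1 ->
  dfdu r u v != 0 /\ dfdv r u v != 0.
Proof.
move=> [_ _ _ /(_ u v) reg] u01 v01; move: reg => /(_ (conj u01 v01)) reg.
split; apply: contraNneq reg => d0; apply/eqP/rowP => i; rewrite !mxE d0 !mxE.
  by rewrite !mul0r subrr.
by rewrite !mulr0 subrr.
Qed.

(** The ratio cannot vanish, since the cross derivative of the upper patch does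
    not. *)
Lemma seam_above {R : realType} (m n m' n' : nat)
    (p : 'I_m.+1 -> 'I_n.+1 -> 'rV[R]_3) (q : 'I_m'.+1 -> 'I_n'.+1 -> 'rV[R]_3) :
  dfdv (bezier q) 0 0 != 0 -> joined_above (bezier p) (bezier q) ->
  seam (uiso p 1) (uiso q 0).
Proof.
move=> q0 [pq0 [c pq1]]; split.
  by apply: unit_interval_curve_eq => u /pq0; rewrite !bezier_uiso.
exists c; last first.
  by apply: unit_interval_curve_eq => u /pq1; rewrite !dfdv_uiso cevalZ hornerC.
apply: contraNneq q0 => c0; rewrite pq1 ?lexx ?ler01// c0 scale0r//.
Qed.

Lemma seam_right {R : realType} (m n m' n' : nat)
    (p : 'I_m.+1 -> 'I_n.+1 -> 'rV[R]_3) (q : 'I_m'.+1 -> 'I_n'.+1 -> 'rV[R]_3) :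
  dfdu (bezier q) 0 0 != 0 -> joined_right (bezier p) (bezier q) ->
  seam (viso p 1) (viso q 0).
Proof.
move=> q0 [pq0 [c pq1]]; apply: seam_above; first by rewrite dfdv_swap swap_netK.
split; first by move=> v /pq0; rewrite (bezier_swap p) (bezier_swap q).
by exists c => v /pq1; rewrite !dfdv_swap !swap_netK.
Qed.

(** The hub h is glued to s along u = x and to t along v = y, and (x, y) is its
    vertex at the hole; x' and y' are the parameters of these seams on s and t.
    Differentiating the identities along the seams expresses the 1-jets and the
    twists of s and t at this vertex by those of h, the twists being d h_uv and
    c h_uv. *)
Lemma hub_corner {R : realType} (m n m1 n1 m2 n2 : nat)
    (h : 'I_m.+1 -> 'I_n.+1 -> 'rV[R]_3) (s : 'I_m1.+1 -> 'I_n1.+1 -> 'rV[R]_3)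
    (t : 'I_m2.+1 -> 'I_n2.+1 -> 'rV[R]_3) (x y x' y' : R) :
  seam (viso h x) (viso s x') -> seam (uiso h y) (uiso t y') ->
  exists al be, [/\ al != 0, be != 0 &
    corner (uiso s y 0) (uiso s y 1) (viso t x 0) (viso t x 1) x' y' al be].
Proof.
move=> [hs0 [d d0 hs1]] [ht0 [c c0 ht1]]; exists c, d; split=> //.
have s0 l : ceval (cderiv 0 (uiso s y l)) x' = ceval (cderiv 0 (uiso h y l)) x.
  by rewrite (mixed_partials s) -hs0 -(mixed_partials h).
have s1 l : ceval (cderiv 1 (uiso s y l)) x' =
    d *: ceval (cderiv 1 (uiso h y l)) x.
  by rewrite (mixed_partials s) hs1 cderivC cevalZ hornerC -(mixed_partials h).
have t0 k : ceval (cderiv 0 (viso t x k)) y' = ceval (cderiv k (uiso h y 0)) x.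
  by rewrite -(mixed_partials t) -ht0.
have t1 k : ceval (cderiv 1 (viso t x k)) y' =
    c *: ceval (cderiv k (uiso h y 1)) x.
  by rewrite -(mixed_partials t) ht1 cderivC cevalZ hornerC.
split.
- by rewrite -[uiso s _ _]cderiv0 -[viso t _ _]cderiv0 s0 t0.
- by rewrite t1 -[uiso s _ _]cderiv0 s0.
- by rewrite s1 -[viso t _ _]cderiv0 t0.
- by rewrite s1 t1 !scalerA mulrC.
Qed.

Lemma poly_G1_condition {R : realType} (lam kap : {poly R})
    (d a b : R -> 'rV[R]_3) :
  (forall t, d t = lam.[t] *: a t + kap.[t] *: b t) -> G1_condition d a b.
Proof.
move=> dE; exists (horner lam), (horner kap).
by split=> [||t _]; first [exact: dE |
  apply: continuous_subspaceT => x; exact: continuous_horner].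
Qed.

Theorem mainTheorem3 (R : realType)
    (q1 q2 q3 q4 q6 q7 q8 q9 : 'I_4 -> 'I_4 -> 'rV[R]_3) :
  let r1 := @bezier R 3 3 q1 in
  let r2 := @bezier R 3 3 q2 in
  let r3 := @bezier R 3 3 q3 in
  let r4 := @bezier R 3 3 q4 in
  let r6 := @bezier R 3 3 q6 in
  let r7 := @bezier R 3 3 q7 in
  let r8 := @bezier R 3 3 q8 in
  let r9 := @bezier R 3 3 q9 in
  C1_sharp r1 -> C1_sharp r2 -> C1_sharp r3 -> C1_sharp r4 ->
  C1_sharp r6 -> C1_sharp r7 -> C1_sharp r8 -> C1_sharp r9 ->
  joined_above r1 r2 -> joined_above r2 r3 ->
  joined_above r7 r8 -> joined_above r8 r9 ->
  joined_right r1 r4 -> joined_right r4 r7 ->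
  joined_right r3 r6 -> joined_right r6 r9 ->
  exists q5 : 'I_6 -> 'I_6 -> 'rV[R]_3,
    let r5 := @bezier R 5 5 q5 in
    (forall u v : R, 0 <= u <= 1 -> 0 <= v <= 1 ->
       [/\ r5 u 0 = r4 u 1, r5 0 v = r2 1 v, r5 u 1 = r6 u 0 & r5 1 v = r8 0 v]) /\
    [/\ G1_condition (fun u => dfdv r5 u 0) (fun u => dfdv r4 u 1) (fun u => dfdu r4 u 1),
        G1_condition (fun v => dfdu r5 0 v) (fun v => dfdu r2 1 v) (fun v => dfdv r2 1 v),
        G1_condition (fun u => dfdv r5 u 1) (fun u => dfdv r6 u 0) (fun u => dfdu r6 u 0) &
        G1_condition (fun v => dfdu r5 1 v) (fun v => dfdu r8 0 v) (fun v => dfdv r8 0 v)].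
Proof.
move=> r1 r2 r3 r4 r6 r7 r8 r9 _ c2 c3 c4 c6 c7 c8 c9.
move=> j12 j23 j78 j89 j14 j47 j36 j69.
have nz (r : R -> R -> 'rV[R]_3) : C1_sharp r ->
    dfdu r 0 0 != 0 /\ dfdv r 0 0 != 0.
  by move=> c; apply: C1_sharp_neq0 => //; rewrite lexx ler01.
have [_ n2] := nz _ c2; have [_ n3] := nz _ c3; have [n4 _] := nz _ c4.
have [n6 _] := nz _ c6; have [n7 _] := nz _ c7; have [_ n8] := nz _ c8.
have [n9u n9v] := nz _ c9.
have [al00 [be00 [a00 b00 cor00]]] :=
  hub_corner (seam_right n4 j14) (seam_above n2 j12).
have [al10 [be10 [a10 b10 cor10]]] :=
  hub_corner (seam_sym (seam_right n7 j47)) (seam_above n8 j78).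
have [al01 [be01 [a01 b01 cor01]]] :=
  hub_corner (seam_right n6 j36) (seam_sym (seam_above n3 j23)).
have [al11 [be11 [a11 b11 cor11]]] :=
  hub_corner (seam_sym (seam_right n9u j69)) (seam_sym (seam_above n9v j89)).
(* The edges with index false are the lower and left ones, those of patches 4
   and 2; the edges with index true belong to patches 6 and 8. *)
have [||||q5 [lam [kap [mu [nu qP]]]]] := @frame_fill R
  (fun l => if l then uiso q6 0 0 else uiso q4 1 0)
  (fun l => if l then uiso q6 0 1 else uiso q4 1 1)
  (fun k => if k then viso q8 0 0 else viso q2 1 0)
  (fun k => if k then viso q8 0 1 else viso q2 1 1)
  (fun k l => if k then if l then al11 else al10 else if l then al01 else al00)
  (fun k l => if k then if l then be11 else be10 else if l then be01 else be00).
- by case; split; exact: cdegree_uiso.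
- by case; case.
- by case; case.
- by case; case.
exists q5 => r5; split.
  move=> u v _ _.
  have [q0v qu0 _ _] := qP false u; have [q1v qu1 _ _] := qP true u.
  have [p0v pu0 _ _] := qP false v; have [p1v pu1 _ _] := qP true v.
  split.
  - by rewrite /r4 bezier_uiso -qu0.
  - by rewrite /r2 bezier_viso -p0v.
  - by rewrite /r6 bezier_uiso -qu1.
  - by rewrite /r8 bezier_viso -p1v.
split.
- apply: (@poly_G1_condition _ (lam false) (kap false)) => t.
  by rewrite (dfdv_uiso q4) (dfdu_uiso q4); have [_ _ _] := qP false t.
- apply: (@poly_G1_condition _ (mu false) (nu false)) => t.
  by rewrite (dfdu_viso q2) (dfdv_viso q2); have [_ _ ] := qP false t.
- apply: (@poly_G1_condition _ (lam true) (kap true)) => t.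
  by rewrite (dfdv_uiso q6) (dfdu_uiso q6); have [_ _ _] := qP true t.
- apply: (@poly_G1_condition _ (mu true) (nu true)) => t.
  by rewrite (dfdu_viso q8) (dfdv_viso q8); have [_ _ ] := qP true t.
Qed.
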